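(* Let $\mathbb{F}$ be a finite field, let $m,n,p,q$ be positive integers, and let $\phi : M_{m \times n}(\mathbb{F}) \to M_{p \times q}(\mathbb{F})$ be a degenerate adjacency preserver. Then the range of $\phi$ is an adjacent set.
   Context: Matrices $A,B$ of the same size over $\mathbb{F}$ are adjacent if $\mathrm{rank}(A-B)=1$. A set of matrices is an adjacent set if any two distinct elements of it are adjacent. An adjacency preserver is a map $\phi$ such that $\phi(A)$ and $\phi(B)$ are adjacent whenever $A$ and $B$ are adjacent (one direction only; no injectivity or surjectivity is assumed). For a nonzero row vector $y\in M_{1\times q}(\mathbb{F})$ put $R(y)=\{vy : v\in M_{p\times 1}(\mathbb{F})\}$, and for a nonzero column vector $x\in M_{p\times 1}(\mathbb{F})$ put $L(x)=\{xu : u\in M_{1\times q}(\mathbb{F})\}$; both are subsets of $M_{p\times q}(\mathbb{F})$. Let $M_{m\times n}^{\le 1}(\mathbb{F})$ be the set of $m\times n$ matrices of rank at most $1$. An adjacency preserver $\phi:M_{m\times n}(\mathbb{F})\to M_{p\times q}(\mathbb{F})$ is degenerate with respect to $A\in M_{m\times n}(\mathbb{F})$ if there are a nonzero $x\in M_{p\times 1}(\mathbb{F})$ and a nonzero $y\in M_{1\times q}(\mathbb{F})$ with $\phi(A+M_{m\times n}^{\le1}(\mathbb{F}))\subset(\phi(A)+R(y))\cup(\phi(A)+L(x))$. It is degenerate if it is degenerate with respect to every $A\in M_{m\times n}(\mathbb{F})$. *)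

(* Defs.v *)
From mathcomp Require Import all_boot all_order all_algebra.

Set Implicit Arguments.
Unset Strict Implicit.
Unset Printing Implicit Defensive.

Import GRing.Theory.
Local Open Scope ring_scope.

Definition adjacent (F : finFieldType) (m n : nat) (A B : 'M[F]_(m, n)) : bool :=
  \rank (A - B) == 1%N.

Definition adjacent_set (F : finFieldType) (m n : nat)
    (S : {set 'M[F]_(m, n)}) : Prop :=
  forall A B, A \in S -> B \in S -> A <> B -> adjacent A B.

Definition adjacency_preserver (F : finFieldType) (m n p q : nat)
    (phi : 'M[F]_(m, n) -> 'M[F]_(p, q)) : Prop :=
  forall A B, adjacent A B -> adjacent (phi A) (phi B).

Definition Rset (F : finFieldType) (p q : nat) (y : 'rV[F]_q) :
    {set 'M[F]_(p, q)} :=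
  [set v *m y | v : 'cV[F]_p].

Definition Lset (F : finFieldType) (p q : nat) (x : 'cV[F]_p) :
    {set 'M[F]_(p, q)} :=
  [set x *m u | u : 'rV[F]_q].

Definition rank_le1 (F : finFieldType) (m n : nat) : {set 'M[F]_(m, n)} :=
  [set N : 'M[F]_(m, n) | (\rank N <= 1)%N].

Definition translate (F : finFieldType) (m n : nat) (A : 'M[F]_(m, n))
    (S : {set 'M[F]_(m, n)}) : {set 'M[F]_(m, n)} :=
  [set A + N | N in S].

Definition degenerate_wrt (F : finFieldType) (m n p q : nat)
    (phi : 'M[F]_(m, n) -> 'M[F]_(p, q)) (A : 'M[F]_(m, n)) : Prop :=
  exists (x : 'cV[F]_p) (y : 'rV[F]_q),
    [/\ x != 0, y != 0 &
        phi @: translate A (rank_le1 F m n)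
          \subset translate (phi A) (Rset p y)
                    :|: translate (phi A) (Lset q x)].

Definition degenerate (F : finFieldType) (m n p q : nat)
    (phi : 'M[F]_(m, n) -> 'M[F]_(p, q)) : Prop :=
  forall A, degenerate_wrt phi A.

(* Main.v *)
(** The key point is that a line [A + F N] has as many points as [F]: an
    adjacency preserver, being injective on adjacent sets, that maps it into a
    line [phi A + F M] maps it onto that line, leaving no room for the image of
    a further point adjacent to all points of [A + F N].  Since [R(y)] and
    [L(x)] meet in the line [F x y], this forces the image of each ball
    [A + M^{<=1}] into one of the two maximal adjacent sets [phi A + R(y)] and
    [phi A + L(x)], and then forces the balls around adjacent points into the
    same maximal adjacent set.  The adjacency graph being connected, that
    set contains the whole range. *)
Require Import Defs.
From mathcomp Require Import all_boot all_order all_algebra.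

Set Implicit Arguments.
Unset Strict Implicit.
Unset Printing Implicit Defensive.

Import GRing.Theory.
Local Open Scope ring_scope.

(** * Row and column factors of matrices of rank at most one *)

Section RankOne.
Variable F : fieldType.
Implicit Types m n : nat.

Lemma rank_le1P m n (N : 'M[F]_(m, n)) :
  (\rank N <= 1)%N -> exists (x : 'cV_m) (u : 'rV_n), N = x *m u.
Proof.
move: (mulmx_base N); move: (col_base N) (row_base N).
case: (\rank N) => [|[|//]] x u <- _; last by exists x, u.
by exists 0, 0; rewrite mulmx0 (flatmx0 u) mulmx0.
Qed.

Lemma rank_mul_le1 m n (x : 'cV[F]_m) (u : 'rV[F]_n) : (\rank (x *m u)%R <= 1)%N.
Proof. exact: leq_trans (mxrankM_maxr _ _) (rank_leq_row _). Qed.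

Lemma rV_rinv n (y : 'rV[F]_n) : y != 0 -> exists z : 'cV_n, y *m z = 1%:M.
Proof.
by move=> y0; exists (pinvmx y); apply: mulmxVp; rewrite /row_free rank_rV y0.
Qed.

Lemma cV_linv m (x : 'cV[F]_m) : x != 0 -> exists z : 'rV_m, z *m x = 1%:M.
Proof.
rewrite -(inj_eq trmx_inj) trmx0 => /rV_rinv[z xz].
by exists z^T; apply: trmx_inj; rewrite trmx_mul trmxK xz trmx1.
Qed.

Lemma mulmx_cV_rV_neq0 m n (x : 'cV[F]_m) (y : 'rV[F]_n) :
  x != 0 -> y != 0 -> x *m y != 0.
Proof.
move=> x0 /rV_rinv[z yz]; apply: contraNneq x0 => /(congr1 (mulmx^~ z)).
by rewrite -mulmxA yz mulmx1 mul0mx => ->.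
Qed.

(** With [y *m z = 1%:M], writing [M] as $vy$ and as $xu'$ gives $M = Mzy = x(u'z)y$, so the scalar
    is $u'z$. *)
Lemma submx_meet m n (x : 'cV[F]_m) (y : 'rV[F]_n) (M : 'M[F]_(m, n)) :
  (M <= y)%MS -> (M^T <= x^T)%MS -> exists d, M = d *: (x *m y).
Proof.
have [->|/rV_rinv[z yz]] := eqVneq y 0.
  by move/submx0null=> -> _; exists 0; rewrite scale0r.
case/submxP=> v Mv /submxP[u /(congr1 trmx)]; rewrite trmxK trmx_mul trmxK => Mu.
exists ((u^T *m z) 0 0); rewrite scalemxAl -mul_mx_scalar -mx11_scalar.
by rewrite mulmxA -Mu Mv -(mulmxA v) yz mulmx1.
Qed.

Lemma submx_rV_sym m n (M : 'M[F]_(m, n)) (y : 'rV[F]_n) :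
  (M <= y)%MS -> M != 0 -> (y <= M)%MS.
Proof.
move=> My M0; have [_ <-] := mxrank_leqif_sup My.
by rewrite eqn_leq mxrankS //= (leq_trans (rank_leq_row _)) // lt0n mxrank_eq0.
Qed.

(* No element of [R(y) \ L(x)] is adjacent to one of [L(x) \ R(y)]. *)
Lemma submx_or_of_rank_le1 m n (x : 'cV[F]_m) (y : 'rV[F]_n)
    (M N : 'M[F]_(m, n)) :
  (M <= y)%MS -> (N^T <= x^T)%MS -> (\rank (M - N)%R <= 1)%N ->
  (M^T <= x^T)%MS \/ (N <= y)%MS.
Proof.
case/submxP=> v -> /submxP[w /(congr1 trmx)]; rewrite trmxK trmx_mul trmxK => ->.
move: w^T => {w} u /rank_le1P[a [b E]].
have [uy|] := boolP (u <= y)%MS; first by right; apply: mulmx_sub.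
have [->|x0] := eqVneq x 0; first by rewrite mul0mx sub0mx; right.
rewrite submxE => /rV_rinv[w uw]; left.
(* Since [u] is outside the span of [y], some [z] is killed by [y] while [u *m z] is 1. Multiplying
   [v *m y - x *m u = a *m b] by [z] leaves [- x] on the left, so [x] is a multiple of [a]. *)
have [z [yz uz]] : exists z : 'cV_n, y *m z = 0 /\ u *m z = 1%:M.
  by exists (cokermx y *m w); rewrite mulmxA mulmx_coker mul0mx (mulmxA u).
have xa : (x^T <= a^T)%MS.
  apply/submxP; exists (- b *m z)^T; rewrite -trmx_mul; congr trmx.
  rewrite mulNmx mulmxN mulmxA -E mulmxBl -!mulmxA yz uz.
  by rewrite mulmx0 mulmx1 sub0r opprK.
have ax : (a^T <= x^T)%MS by apply: submx_rV_sym xa _; rewrite trmx_eq0.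
have -> : v *m y = a *m b + x *m u by rewrite -E subrK.
by rewrite linearD /= !trmx_mul addmx_sub ?mulmx_sub.
Qed.

End RankOne.

(** * Images of balls, and propagation from ball to ball *)

Section Degenerate.
Variables (F : finFieldType) (m n : nat).
Implicit Types A B C N : 'M[F]_(m, n).

(** Row-space inclusion in [y] encodes membership in $R(y)$; the case $L(x)$ is the same predicate
    for [transpose_map phi]. *)
Definition ball_sub_rows p q (phi : 'M[F]_(m, n) -> 'M[F]_(p, q)) A :=
  exists y : 'rV_q, forall B, (\rank (B - A)%R <= 1)%N -> (phi B - phi A <= y)%MS.

(** Only the target is transposed, so the domain, its balls and the condition [1 < n] are the same
    in both cases. *)
Definition transpose_map p q (phi : 'M[F]_(m, n) -> 'M[F]_(p, q)) A := (phi A)^T.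

Section Preserver.
Variables (p q : nat) (phi : 'M[F]_(m, n) -> 'M[F]_(p, q)).
Hypothesis phi_adj : adjacency_preserver phi.

Lemma preserver_rank_le1 A B :
  (\rank (A - B)%R <= 1)%N -> (\rank (phi A - phi B)%R <= 1)%N.
Proof.
rewrite leq_eqVlt => /orP[/phi_adj/eqP -> //|].
by rewrite ltnS leqn0 mxrank_eq0 subr_eq0 => /eqP ->; rewrite subrr mxrank0.
Qed.

Lemma preserver_inj A B : (\rank (A - B)%R <= 1)%N -> phi A = phi B -> A = B.
Proof.
rewrite leq_eqVlt => /orP[/phi_adj|]; last first.
  by rewrite ltnS leqn0 mxrank_eq0 subr_eq0 => /eqP.
by rewrite /adjacent => + E; rewrite E subrr mxrank0.
Qed.

(** Pigeonhole: the line through [A] along [N] has $|\mathbb{F}|$ distinct images in a set of at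
    most $|\mathbb{F}|$ points, so it fills that set. Hence [phi (A + N')] is the image of some
    point of the line, and injectivity at rank distance at most one identifies the two points. *)
Lemma line_saturated A N N' (M : 'M[F]_(p, q)) :
  (\rank N <= 1)%N -> N != 0 -> (forall c, \rank (N' - c *: N)%R <= 1)%N ->
  (forall c, exists d, phi (A + c *: N) - phi A = d *: M) ->
  (exists d, phi (A + N') - phi A = d *: M) -> exists c, N' = c *: N.
Proof.
move=> N1 N0 NN' lineN [d' lineN'].
pose S := [set phi (A + c *: N) | c : F]; pose T := [set phi A + d *: M | d : F].
have injS : injective (fun c => phi (A + c *: N)).
  move=> c d /preserver_inj E; apply/eqP; rewrite -subr_eq0.
  have /E/addrI/eqP : (\rank (A + c *: N - (A + d *: N))%R <= 1)%N.
    rewrite opprD addrACA subrr add0r -scalerBl.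
    exact: leq_trans (mxrank_scale _ _) N1.
  by rewrite -subr_eq0 -scalerBl scaler_eq0 (negPf N0) orbF.
have /eqP ST : S == T.
  rewrite eqEcard; apply/andP; split.
    apply/subsetP=> _ /imsetP[c _ ->]; have [d E] := lineN c.
    by apply/imsetP; exists d; rewrite // -E subrKC.
  by rewrite (card_imset _ injS) leq_imset_card.
have : phi (A + N') \in S.
  by rewrite ST; apply/imsetP; exists d'; rewrite // -lineN' subrKC.
case/imsetP=> c _ E; exists c; apply: (addrI A).
by apply: preserver_inj E; rewrite opprD addrACA subrr add0r.
Qed.

(** Suppose that, relative to [A], the image of [x1 *m y1] misses $R(y)$ and that of [x2 *m y2]
    misses $L(x)$. Then the lines spanned by the mixed products [x2 *m y1] and [x1 *m y2] both map
    into $R(y) \cap L(x)$ and saturate it. *)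
Lemma degenerate_wrt_rows_or_cols A : degenerate_wrt phi A ->
  ball_sub_rows phi A \/ ball_sub_rows (transpose_map phi) A.
Proof.
case=> x [y [_ _ /subsetP deg]].
pose D N := phi (A + N) - phi A.
pose inR N := (D N <= y)%MS; pose inL N := ((D N)^T <= x^T)%MS.
have RL N : (\rank N <= 1)%N -> inR N || inL N.
  move=> N1; have /deg : phi (A + N) \in phi @: translate A (rank_le1 F m n).
    by apply: imset_f; apply: imset_f; rewrite inE.
  rewrite inE => /orP[] /imsetP[_ /imsetP[z _ ->]] E; apply/orP.
    by left; rewrite /inR /D E addrC addKr submxMl.
  by right; rewrite /inL /D E addrC addKr trmx_mul submxMl.
have cliqueR N N' : (\rank N <= 1)%N -> (\rank N' <= 1)%N ->
    (\rank (N - N')%R <= 1)%N -> ~~ inL N -> inR N'.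
  move=> N1 N'1 NN' notL; have := RL _ N1; have := RL _ N'1.
  rewrite (negPf notL) orbF => /orP[//|L'] R.
  have [|L|//] := @submx_or_of_rank_le1 _ _ _ x y (D N) (D N') R L'.
    rewrite /D opprD opprK addrACA addNr addr0; apply: preserver_rank_le1.
    by rewrite opprD addrACA subrr add0r.
  by case/negP: notL.
have cliqueL N N' : (\rank N <= 1)%N -> (\rank N' <= 1)%N ->
    (\rank (N - N')%R <= 1)%N -> ~~ inR N -> inL N'.
  move=> N1 N'1 NN' notR; apply: contraNT notR; apply: cliqueR => //.
  by rewrite -mxrank_opp opprB.
have line N N' : (\rank N <= 1)%N -> N != 0 -> (\rank N' <= 1)%N ->
    (forall c, \rank (N' - c *: N)%R <= 1)%N ->
    (forall c, inR (c *: N)) -> (forall c, inL (c *: N)) -> inR N' -> inL N' ->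
    exists c, N' = c *: N.
  move=> N1 N0 N'1 NN' R L R' L'.
  apply: (@line_saturated A N N' (x *m y)) => //; last exact: submx_meet R' L'.
  by move=> c; apply: submx_meet (R c) (L c).
case: (boolP [forall N, (\rank N <= 1)%N ==> inR N]) => [/forallP allR|].
  left; exists y => B BA; have := implyP (allR (B - A)) BA.
  by rewrite /inR /D subrKC.
case/forallPn=> N1; rewrite negb_imply => /andP[/rank_le1P[x1 [y1 ->]] notR].
case: (boolP [forall N, (\rank N <= 1)%N ==> inL N]) => [/forallP allL|].
  right; exists x^T => B BA; have := implyP (allL (B - A)) BA.
  by rewrite /inL /D /transpose_map (addrC A) subrK linearB.
case/forallPn=> N2; rewrite negb_imply => /andP[/rank_le1P[x2 [y2 ->]] notL].
(* A shared row or column factor keeps the rank of the difference at most one. *)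
have L1 u : inL (x1 *m u).
  by apply: cliqueL notR; rewrite -?mulmxBr rank_mul_le1.
have L1' v : inL (v *m y1).
  by apply: cliqueL notR; rewrite -?mulmxBl rank_mul_le1.
have R2 u : inR (x2 *m u).
  by apply: cliqueR notL; rewrite -?mulmxBr rank_mul_le1.
have R2' v : inR (v *m y2).
  by apply: cliqueR notL; rewrite -?mulmxBl rank_mul_le1.
have inR0 : inR 0 by rewrite /inR /D addr0 subrr sub0mx.
have inL0 : inL 0 by rewrite /inL /D addr0 subrr trmx0 sub0mx.
have [x1_0 y1_0] : x1 != 0 /\ y1 != 0.
  by split; apply: contraNneq notR => ->; rewrite ?mul0mx ?mulmx0.
have [x2_0 y2_0] : x2 != 0 /\ y2 != 0.
  by split; apply: contraNneq notL => ->; rewrite ?mul0mx ?mulmx0.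
(* This point shares [y1], hence satisfies [inL]. If it also satisfies [inR], saturation makes it a
   multiple of [x2 *m y1], so [x1 *m y1] has the form [x2 *m u], against [notR]. Otherwise
   [(x1 + x2) *m y2] yields the mirror contradiction with [notL]. *)
have [R3|notR3] := boolP (inR ((x1 + x2) *m y1)).
  have [||||||//|//|c] := line (x2 *m y1) ((x1 + x2) *m y1).
  - exact: rank_mul_le1.
  - exact: mulmx_cV_rV_neq0.
  - exact: rank_mul_le1.
  - by move=> c; rewrite scalemxAl -mulmxBl rank_mul_le1.
  - by move=> c; rewrite scalemxAr.
  - by move=> c; rewrite scalemxAl.
  rewrite mulmxDl => /(canRL (addrK _)) E; case/negP: notR.
  by rewrite E scalemxAr -mulmxBr.
have L3 : inL ((x1 + x2) *m y2).
  by apply: cliqueL notR3; rewrite -?mulmxBr rank_mul_le1.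
have [||||||//|//|c] := line (x1 *m y2) ((x1 + x2) *m y2).
- exact: rank_mul_le1.
- exact: mulmx_cV_rV_neq0.
- exact: rank_mul_le1.
- by move=> c; rewrite scalemxAl -mulmxBl rank_mul_le1.
- by move=> c; rewrite scalemxAl.
- by move=> c; rewrite scalemxAr.
rewrite mulmxDl addrC => /(canRL (addrK _)) E; case/negP: notL.
by rewrite E scalemxAr -mulmxBr.
Qed.

End Preserver.

(** If the ball at [B] is of row type, the nonzero vector [phi B - phi A] forces the same row line.
    If it is of column type, write $B - A = vu$: all points $A + vw$ lie in both balls, so their
    images lie on one line, which the points $A + cvu$ already fill. Every $w$ is then a multiple of
    $u$, impossible for $n > 1$. *)
Lemma ball_sub_rows_adjacent p q (phi : 'M[F]_(m, n) -> 'M[F]_(p, q))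
    (y : 'rV_q) A B :
  adjacency_preserver phi -> (1 < n)%N -> degenerate_wrt phi B ->
  adjacent B A ->
  (forall C, (\rank (C - A)%R <= 1)%N -> (phi C - phi A <= y)%MS) ->
  forall C, (\rank (C - B)%R <= 1)%N -> (phi C - phi B <= y)%MS.
Proof.
move=> phi_adj n_gt1 degB BA ballA.
have phiBA : phi B - phi A != 0 by rewrite -mxrank_eq0 (eqP (phi_adj _ _ BA)).
have BAy : (phi B - phi A <= y)%MS by rewrite ballA // (eqP BA).
have [[y' ballB]|[x ballB]] := degenerate_wrt_rows_or_cols phi_adj degB.
  move=> C /ballB /submx_trans; apply; apply: submx_trans BAy.
  apply: submx_rV_sym phiBA; rewrite -opprB eqmx_opp ballB //.
  by rewrite -mxrank_opp opprB (eqP BA).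
exfalso; move: BA; rewrite /adjacent => /eqP BA.
have [v [u uvE]] : exists (v : 'cV_m) (u : 'rV_n), B - A = v *m u.
  by apply: rank_le1P; rewrite BA.
have lineE w : exists d, phi (A + v *m w) - phi A = d *: (x^T *m y).
  apply: submx_meet; first by rewrite ballA // addrC addKr rank_mul_le1.
  have -> : phi (A + v *m w) - phi A =
            (phi (A + v *m w) - phi B) - (phi A - phi B).
    by rewrite opprB addrA subrK.
  rewrite trmxK [X in (X <= _)%MS]linearB addmx_sub //= ?eqmx_opp.
    rewrite linearB; apply: ballB.
    have -> : A + v *m w - B = v *m (w - u).
      by rewrite mulmxBr -uvE opprB addrA [A + _]addrC.
    exact: rank_mul_le1.
  by rewrite linearB; apply: ballB; rewrite -mxrank_opp opprB BA.
have line w : exists c, v *m w = c *: (v *m u).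
  apply: (line_saturated phi_adj (A := A) (M := x^T *m y)) => //.
  - exact: rank_mul_le1.
  - by rewrite -uvE -mxrank_eq0 BA.
  - by move=> c; rewrite scalemxAr -mulmxBr rank_mul_le1.
  - by move=> c; rewrite scalemxAr.
have /cV_linv[z zv] : v != 0.
  apply/eqP=> v0; move: uvE; rewrite v0 mul0mx => BA0.
  by rewrite BA0 mxrank0 in BA.
have full_u : (1%:M <= u)%MS.
  apply/row_subP=> i; have [c] := line (row i 1%:M).
  move/(congr1 (mulmx z)); rewrite -scalemxAr !mulmxA zv !mul1mx => ->.
  exact: scalemx_sub.
by move: (leq_trans (mxrankS full_u) (rank_leq_row u)); rewrite mxrank1 leqNgt n_gt1.
Qed.

Lemma degenerate_sub_rows p q (phi : 'M[F]_(m, n) -> 'M[F]_(p, q)) A0 :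
  adjacency_preserver phi -> (1 < n)%N -> degenerate phi ->
  ball_sub_rows phi A0 ->
  exists y : 'rV_q, forall A B, (phi A - phi B <= y)%MS.
Proof.
move=> phi_adj n_gt1 phi_deg [y ball0].
pose P B := (phi B - phi A0 <= y)%MS /\
  forall C, (\rank (C - B)%R <= 1)%N -> (phi C - phi B <= y)%MS.
(* Connectedness as an induction: [Q] is closed under sums and holds at rank at most one, hence
   everywhere, since any matrix is a sum of scaled matrix units. *)
pose Q N := forall B, P B -> P (B + N).
have Q0 : Q 0 by move=> B; rewrite addr0.
have QD N N' : Q N -> Q N' -> Q (N + N').
  by move=> QN QN' B /QN/QN'; rewrite addrA.
have Q1 N : (\rank N <= 1)%N -> Q N.
  rewrite leq_eqVlt => /orP[/eqP N1|]; last first.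
    by rewrite ltnS leqn0 mxrank_eq0 => /eqP ->.
  move=> B [B0 ballB]; have NE : B + N - B = N by rewrite addrC addKr.
  split; first by rewrite -(subrK (phi B) (phi _)) -addrA addmx_sub ?ballB ?NE ?N1.
  by apply: ball_sub_rows_adjacent ballB; rewrite // /adjacent NE N1.
have PA A : P A.
  rewrite -(subrK A0 A) addrC; move: (A - A0) => {A} N.
  have: P A0 by split=> //; rewrite subrr sub0mx.
  suff: Q N by apply.
  rewrite (matrix_sum_delta N); apply: (big_ind Q) => // i _.
  apply: (big_ind Q) => // j _; apply: Q1.
  by rewrite (leq_trans (mxrank_scale _ _)) // mxrank_delta.
exists y => A B; rewrite -(subrKA (phi A0)) addmx_sub ?(PA A).1 //.
by rewrite -opprB eqmx_opp (PA B).1.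
Qed.

End Degenerate.

(** * Exchange of $R(y)$ and $L(x)$ by transposition *)

Section Transpose.
Variables (F : finFieldType) (m n p q : nat) (phi : 'M[F]_(m, n) -> 'M[F]_(p, q)).

Lemma transpose_preserver :
  adjacency_preserver phi -> adjacency_preserver (transpose_map phi).
Proof.
move=> phi_adj A B /phi_adj.
by rewrite /adjacent /transpose_map -linearB mxrank_tr.
Qed.

Lemma transpose_degenerate : degenerate phi -> degenerate (transpose_map phi).
Proof.
move=> phi_deg A; have [x [y [x0 y0 /subsetP deg]]] := phi_deg A.
exists y^T, x^T; rewrite !trmx_eq0; split=> //; apply/subsetP=> _ /imsetP[B BA ->].
have /deg := imset_f phi BA.
rewrite inE => /orP[] /imsetP[_ /imsetP[v _ ->]] E; rewrite inE; apply/orP.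
  by right; rewrite /transpose_map E linearD /= trmx_mul; do 2!apply: imset_f.
by left; rewrite /transpose_map E linearD /= trmx_mul; do 2!apply: imset_f.
Qed.

End Transpose.

Local Close Scope ring_scope.

Theorem theorem1p3 (F : finFieldType) (m n p q : nat)
    (m_gt0 : 0 < m) (n_gt0 : 0 < n) (p_gt0 : 0 < p) (q_gt0 : 0 < q)
    (phi : 'M[F]_(m, n) -> 'M[F]_(p, q))
    (phi_adj : adjacency_preserver phi) (phi_deg : degenerate phi) :
  adjacent_set (phi @: [set: 'M[F]_(m, n)]).
Proof.
suff rank1 A B : (\rank (phi A - phi B)%R <= 1)%N.
  move=> _ _ /imsetP[A _ ->] /imsetP[B _ ->] /eqP AB.
  by rewrite /adjacent eqn_leq rank1 lt0n mxrank_eq0 subr_eq0.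
(* For a single column any two matrices of the domain are equal or adjacent, so preservation alone
   suffices. *)
have [n_gt1|n_le1] := ltnP 1 n; last first.
  by apply: preserver_rank_le1 => //; apply: leq_trans (rank_leq_col _) n_le1.
have [ball0|ball0] := degenerate_wrt_rows_or_cols phi_adj (phi_deg 0%R).
  have [y suby] := degenerate_sub_rows phi_adj n_gt1 phi_deg ball0.
  exact: leq_trans (mxrankS (suby A B)) (rank_leq_row _).
have [y suby] := degenerate_sub_rows (transpose_preserver phi_adj) n_gt1
  (transpose_degenerate phi_deg) ball0.
rewrite -mxrank_tr linearB; exact: leq_trans (mxrankS (suby A B)) (rank_leq_row _).
Qed.
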